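(* Let $(X,d)$ be a $Q$-ary distance-regular space of dimension $N\ge2$ over $\mathbb{F}_Q$. Let $0\le t<N$ be an integer, and let $\mathcal{D}\le X$ be a $t$-dimensional linear code with $d(\mathcal{D})\ge2$. Let $k$ and $d$ be any integers that satisfy $t\le k\le N$ and $2\le d\le d(\mathcal{D})$. Define the families of linear codes $\mathcal{F}:=\{\mathcal{C}\le X\mid\mathcal{D}\le\mathcal{C},\ \dim(\mathcal{C})=k\}$ and $\mathcal{F}':=\{\mathcal{C}\le X\mid\mathcal{D}\le\mathcal{C},\ \dim(\mathcal{C})=k,\ d(\mathcal{C})<d\}$. Then $$\frac{|\mathcal{F}'|}{|\mathcal{F}|}\le\frac{Q^k-Q^t}{(Q-1)(Q^N-Q^t)}\left(\boldsymbol{b}(d-1)-1\right).$$ In particular, for all integers $k$ and $d$ with $0\le k\le N$ and $d\ge2$, there exist at most $$\frac{Q^k-1}{(Q-1)(Q^N-1)}\left[\begin{matrix}N\\k\end{matrix}\right]_Q\left(\boldsymbol{b}(d-1)-1\right)$$ linear codes $\mathcal{C}\le X$ of dimension $k$ over $\mathbb{F}_Q$ and minimum distance $<d$.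
   Context: Let $Q$ be a prime power, $X$ a finite-dimensional $\mathbb{F}_Q$-vector space and $d:X\times X\to\mathbb{N}$ an integer-valued distance function (the letter $d$ is also used for an integer and for the minimum distance $d(\mathcal{C})$). $(X,d)$ is a $Q$-ary distance-regular space if: (1) $d(\alpha x,\alpha y)=d(x,y)$ for all $x,y\in X$, $\alpha\in\mathbb{F}_Q\setminus\{0\}$; (2) $d(x,y)=d(0,x-y)$ for all $x,y\in X$; (3) for all $x,y\in X$ and $j,k\in\mathbb{N}$, $|\{z\in X\mid d(z,x)=j,\ d(z,y)=k\}|$ depends only on $d(x,y)$ (and $j,k$); (4) with $\omega(x):=d(x,0)$ the weight, $\max\{\omega(x)\mid x\in X\}=|\omega(X)|-1$. Linear codes are $\mathbb{F}_Q$-subspaces of $X$, written $\mathcal{C}\le X$. The minimum distance of a linear code $\mathcal{C}\neq\{0\}$ is $d(\mathcal{C}):=\min\{d(x,y)\mid x,y\in\mathcal{C},\ x\ne y\}$, and $d(\{0\}):=+\infty$. For $r\in\mathbb{N}$, $\boldsymbol{b}(r)$ is the cardinality of the ball $\{y\in X\mid d(x,y)\le r\}$, which does not depend on $x\in X$. $\left[\begin{matrix}N\\k\end{matrix}\right]_Q$ is the $Q$-binomial coefficient (the number of $k$-dimensional subspaces of $\mathbb{F}_Q^N$). *)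

(* Defs.v *)
From HB Require Import structures.
From mathcomp Require Import all_boot all_order all_algebra all_field.
From mathcomp Require Import constructive_ereal.

Set Implicit Arguments.
Unset Strict Implicit.
Unset Printing Implicit Defensive.

Import Order.TTheory GRing.Theory Num.Theory.
Local Open Scope ring_scope.

(* Over a finite field there are finitely many subspaces, so that families of
   linear codes can be counted with {set {vspace X}} and #|_|. *)
HB.instance Definition _ (F : finFieldType) (X : vectType F) :=
  Choice_isCountable.Build {vspace X}
    (pcan_pickleK (can_pcan (@VectorInternalTheory.vs2mxK F X))).
HB.instance Definition _ (F : finFieldType) (X : vectType F) :=
  isFinite.Build {vspace X}
    (pcan_enumP (can_pcan (@VectorInternalTheory.vs2mxK F X))).

Record is_distance (X : Type) (d : X -> X -> nat) : Prop := IsDistance {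
  dist_eq0 : forall x y, d x y = 0%N <-> x = y;
  dist_sym : forall x y, d x y = d y x;
  dist_triangle : forall x y z, (d x z <= d x y + d y z)%N
}.

Section DistanceRegular.
Variables (F : finFieldType) (X : vectType F) (d : X -> X -> nat).

(* [finvect_type X] is X itself, equipped with its finite type structure. *)
Local Notation fX := (finvect_type X).

Definition weight (x : X) : nat := d x 0.

Record distance_regular : Prop := DistanceRegular {
  dr_dist : is_distance d;
  dr_scale : forall (a : F) (x y : X), a != 0 -> d (a *: x) (a *: y) = d x y;
  dr_trans : forall x y : X, d x y = d 0 (x - y);
  dr_regular : forall (x y x' y' : X), d x y = d x' y' -> forall j k : nat,
    #|[set z : fX | (d z x == j) && (d z y == k)]|
      = #|[set z : fX | (d z x' == j) && (d z y' == k)]|;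
  dr_weight : \max_(x : fX) weight x
                = (size (undup [seq weight x | x : fX]) - 1)%N
}.

(* The minimum over the empty index set, i.e. for C = 0, is +oo. *)
Definition min_dist (C : {vspace X}) : \bar int :=
  \big[Order.min/+oo%E]_(p : fX * fX |
     [&& p.1 \in C, p.2 \in C & p.1 != p.2]) ((d p.1 p.2)%:Z)%:E.

Definition ball (x : X) (r : nat) : {set fX} := [set y : fX | (d x y <= r)%N].

(* The centre is irrelevant, see [card_ball]. *)
Definition ball_size (r : nat) : nat := #|ball 0 r|.

Lemma card_ball : distance_regular ->
  forall (x : X) (r : nat), #|ball x r| = ball_size r.
Proof.
move=> [_ _ dT _ _] x r; rewrite /ball_size.
have injx : injective (fun y : fX => (y : X) + x : fX) by apply: addIr.
rewrite -(card_imset (ball 0 r) injx); apply: eq_card => y.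
apply/idP/imsetP => [|[z]]; rewrite !inE.
  rewrite dT => h; exists ((y : X) - x : X); last by rewrite subrK.
  by rewrite inE dT sub0r opprB.
by rewrite dT sub0r => h ->; rewrite dT opprD addrCA subrr addr0.
Qed.

End DistanceRegular.

(* The Q-binomial coefficient [N choose k]_Q for Q = #|F|. *)
Definition qbinom (F : finFieldType) (N k : nat) : nat :=
  #|[set U : {vspace 'rV[F]_N} | \dim U == k]|.

(* Main.v *)
(* Double counting. The automorphisms of X fixing D pointwise act transitively
   on X \ D, so every vector outside D lies in the same number n of
   k-dimensional C containing D; counting pairs (x, C) with x in C \ D gives
   n (Q^N - Q^t) = |F| (Q^k - Q^t). A bad C contains a nonzero word of weight
   < d, hence all its Q - 1 nonzero multiples, and none of these lies in D as
   d <= d(D). Counting pairs (x, C) with 0 < weight x < d therefore gives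
   (Q - 1) |F'| <= n (b(d - 1) - 1). The second claim is the case D = 0. *)
Require Import Defs.
From mathcomp Require Import all_boot all_order all_algebra all_field.
From mathcomp Require Import constructive_ereal ring.

Local Open Scope ring_scope.

Import Order.TTheory GRing.Theory Num.Theory passmx.

(* For an abstract X, the types {vspace X} and {vspace (finvect_type X)} are not
   convertible; destructing X makes them so, and card_vspace applies. *)
Lemma card_set_vspace (F : finFieldType) (X : vectType F) (C : {vspace X}) :
  #|[set x : finvect_type X | x \in C]| = (#|F| ^ \dim C)%N.
Proof.
rewrite cardsE; case: X C => T cT C.
exact: (@card_vspace F (finvect_type (Vector.Pack cT))).
Qed.

(** * Counting the subspaces that contain a given subspace *)

Section Subspaces.
Context {F : finFieldType} {X : vectType F}.
Local Notation fX := (finvect_type X).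
Implicit Types (C D : {vspace X}) (x y : X).

(** The block [vbasis D] is the same for every [x], so a linear map matching two such bases fixes
    [D] pointwise. *)
Lemma basis_of_notin D x : x \notin D ->
  exists s, basis_of fullv (x :: vbasis D ++ s).
Proof.
move=> xD; exists (vbasis (<[x]> + D)^C)%VS.
rewrite -(addv_complf (<[x]> + D)%VS) -cat_cons; apply: cat_basis.
- by apply/directv_addP; apply: capv_compl.
- have /andP[/eqP spanD freeD] := vbasisP D.
  by rewrite /basis_of span_cons spanD eqxx free_cons spanD xD.
- exact: vbasisP.
Qed.

Lemma exists_lfun_notin D x y : x \notin D -> y \notin D ->
  exists f : 'End(X), [/\ lker f == 0%VS, (f @: D = D)%VS & f x = y].
Proof.
move=> /basis_of_notin[s /andP[/eqP xspan xfree]].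
move=> /basis_of_notin[s' /andP[/eqP yspan yfree]].
have [f fE] := linear_of_free (x :: vbasis D ++ s) (y :: vbasis D ++ s').
(* Both lists are bases of [X], hence equally long. *)
have szE : size (y :: vbasis D ++ s') = size (x :: vbasis D ++ s).
  by rewrite -(eqP xfree) -(eqP yfree) xspan yspan.
have {fE} := fE xfree szE.
have -> : [seq f i | i <- x :: vbasis D ++ s]
          = [seq linfun f i | i <- x :: vbasis D ++ s].
  by apply: eq_map => i; rewrite lfunE.
set g := linfun f => gE; exists g.
have [gx /eqP] : g x = y /\ [seq g i | i <- vbasis D ++ s] = vbasis D ++ s'.
  by case: gE.
rewrite map_cat eqseq_cat ?size_map // => /andP[/eqP gD _].
split=> //.
(* The image contains a basis, so [g] is onto, and rank-nullity makes its kernel trivial. *)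
- have gfull : limg g = fullv.
    by rewrite -{1}xspan limg_span gE yspan.
  have /eqP := limg_ker_dim g fullv.
  by rewrite gfull capfv -{2}[\dim {:X}]add0n eqn_add2r dimv_eq0.
- by rewrite -{1}(span_basis (vbasisP D)) limg_span gD (span_basis (vbasisP D)).
Qed.

Lemma lker0_limg_inj (Y : vectType F) (f : 'Hom(X, Y)) :
  lker f == 0%VS -> injective (fun C : {vspace X} => (f @: C)%VS).
Proof.
move=> f0 U V /eqP; rewrite eqEsubv !limg_ker0 // -eqEsubv.
by move/eqP.
Qed.

Definition superspaces D k : {set {vspace X}} :=
  [set C : {vspace X} | (D <= C)%VS && (\dim C == k)].

(** An automorphism that preserves [D] and sends [x] to [y] maps the first family injectively into
    the second; exchanging [x] and [y] then gives equality. *)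
Lemma leq_card_superspaces_mem D k x y : x \notin D -> y \notin D ->
  (#|[set C in superspaces D k | x \in C]|
     <= #|[set C in superspaces D k | y \in C]|)%N.
Proof.
move=> xD yD; have [f [f0 fD fx]] := exists_lfun_notin D x y xD yD.
rewrite -(card_imset _ (lker0_limg_inj X f f0)); apply/subset_leq_card.
apply/subsetP=> _ /imsetP[C + ->]; rewrite !inE => /andP[/andP[DC /eqP dC] xC].
rewrite -fx memv_img // -[X in (X <= _)%VS]fD limgS // limg_dim_eq ?dC ?eqxx //.
by rewrite (eqP f0) capv0.
Qed.

Lemma card_superspaces_mem D k x y : x \notin D -> y \notin D ->
  #|[set C in superspaces D k | x \in C]|
    = #|[set C in superspaces D k | y \in C]|.
Proof. by move=> xD yD; apply/eqP; rewrite eqn_leq !leq_card_superspaces_mem. Qed.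

(** Pairs [(x, C)] counted in both orders. [A] will be the complement of [D], then the set of
    nonzero words of weight below [d]. *)
Lemma sum_card_superspaces_mem D k (A : {pred fX}) :
  (\sum_(x : fX | x \in A) #|[set C in superspaces D k | x \in C]|
    = \sum_(C in superspaces D k) #|[set x : fX | (x \in A) && (x \in C)]|)%N.
Proof.
under eq_bigr do rewrite -sum1dep_card big_mkcondr.
by rewrite exchange_big; apply: eq_bigr => C _; rewrite -sum1dep_card big_mkcondr.
Qed.

Lemma card_vspaceD C D : (D <= C)%VS ->
  #|[set x : fX | (x \notin D) && (x \in C)]| = (#|F| ^ \dim C - #|F| ^ \dim D)%N.
Proof.
move=> DC.
have <- : #|[set x : fX | x \in C] :\: [set x : fX | x \in D]|
    = #|[set x : fX | (x \notin D) && (x \in C)]|.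
  by apply: eq_card => x; rewrite !inE.
rewrite cardsD (setIidPr _) ?card_set_vspace //.
by apply/subsetP=> x; rewrite !inE; apply: subvP.
Qed.

Lemma card_superspaces_mem_mul D k x : x \notin D ->
  (#|[set C in superspaces D k | x \in C]| * (#|F| ^ \dim {:X} - #|F| ^ \dim D)
    = #|superspaces D k| * (#|F| ^ k - #|F| ^ \dim D))%N.
Proof.
move=> xD; have := sum_card_superspaces_mem D k [pred x | x \notin D].
have -> : (\sum_(C in superspaces D k)
    #|[set x : fX | (x \in [pred x | x \notin D]) && (x \in C)]|
    = #|superspaces D k| * (#|F| ^ k - #|F| ^ \dim D))%N.
  rewrite -sum_nat_const; apply: eq_bigr => C; rewrite inE => /andP[DC /eqP <-].
  exact: card_vspaceD.
(* Read with [C] the whole space, [card_vspaceD] turns the factor into the number of vectors outside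
   [D], each contributing the same count. *)
move=> <-; rewrite -card_vspaceD ?subvf // mulnC -sum_nat_const.
rewrite (eq_bigl (fun y : fX => y \notin D)); last first.
  by move=> y; rewrite inE memvf andbT.
by apply: eq_bigr => y yD; apply: card_superspaces_mem.
Qed.

(** Coordinates in a basis of [X] give an injective linear map to row vectors, which preserves
    dimensions of subspaces. *)
Lemma leq_card_qbinom k :
  (#|[set C : {vspace X} | \dim C == k]| <= qbinom F (\dim {:X}) k)%N.
Proof.
pose g := linfun (rVof (vbasis {:X})).
have g0 : lker g == 0%VS.
  apply/lker0P=> u v; rewrite !lfunE.
  exact: (can_inj (rVofK (vbasisP {:X}))).
rewrite -(card_imset _ (lker0_limg_inj _ _ g0)); apply/subset_leq_card.
apply/subsetP=> _ /imsetP[C + ->]; rewrite !inE => /eqP <-.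
by rewrite limg_dim_eq // (eqP g0) capv0.
Qed.

End Subspaces.

(** * Minimum distance and the number of bad codes *)

Section Codes.
Context {F : finFieldType} {X : vectType F} {dist : X -> X -> nat}.
Hypothesis hX : distance_regular dist.
Local Notation fX := (finvect_type X).

Lemma min_dist_geP (C : {vspace X}) (d : nat) :
  reflect (forall x, x \in C -> x != 0 -> (d <= dist 0 x)%N)
          (d%:Z%:E <= min_dist dist C)%E.
Proof.
apply: (iffP (bigmin_geP _ _ _ _)) => [[_ dC] x xC x0|dC].
  rewrite -lez_nat -lee_fin; apply: (dC ((0 : X) : fX, x : fX)).
  by apply/and3P; split; [apply: mem0v | apply: xC | rewrite eq_sym].
(* The bound must hold for the initial value [+oo] and for each pair; by translation invariance a
   pair reduces to the codeword [x - y]. *)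
split=> [|[x y] /= /and3P[xC yC xy]]; first exact: leey.
by rewrite lee_fin lez_nat (dr_trans hX) dC ?memvB // subr_eq0.
Qed.

Lemma dist0Z (a : F) (x : X) : a != 0 -> dist 0 (a *: x) = dist 0 x.
Proof. by move=> a0; rewrite -{1}(scaler0 X a) (dr_scale hX). Qed.

Lemma ball_size_gt0 (d : nat) : (0 < ball_size dist d)%N.
Proof.
apply/card_gt0P; exists (0 : X); rewrite inE.
by have -> : dist 0 0 = 0%N by apply/(dist_eq0 (dr_dist hX)).
Qed.

Lemma card_ball_notin0 (d : nat) :
  #|[set x : fX | (x != 0) && (dist 0 x <= d)%N]| = (ball_size dist d - 1)%N.
Proof.
rewrite /ball_size (cardsD1 (0 : fX) (ball dist 0 d)) inE.
have -> : dist 0 0 = 0%N by apply/(dist_eq0 (dr_dist hX)).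
by rewrite addnC addnK; apply: eq_card => x; rewrite !inE.
Qed.

Lemma leq_card_light_words (C : {vspace X}) (d : nat) : (0 < d)%N ->
  (min_dist dist C < d%:Z%:E)%E ->
  (#|F|.-1 <= #|[set x : fX | [&& x != 0%R, (dist 0 x <= d - 1)%N & x \in C]]|)%N.
Proof.
move=> d0; rewrite ltNge => dC.
have [x /and3P[xC x0 xd]] : exists x : fX, [&& x \in C, x != 0 & (dist 0 x < d)%N].
  apply/existsP; apply: contraR dC => /existsPn H; apply/min_dist_geP => x xC x0.
  by have := H x; rewrite xC x0 /= -leqNgt.
have inj : injective (fun a : F => a *: x : fX).
  move=> a b /eqP; rewrite -subr_eq0 -scalerBl scaler_eq0 (negPf x0) orbF.
  by rewrite subr_eq0 => /eqP.
rewrite -(cardC1 (0 : F)) -(card_imset _ inj); apply/subset_leq_card.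
apply/subsetP=> _ /imsetP[a + ->]; rewrite !inE => a0.
apply/and3P; split; last exact: memvZ.
  by apply/eqP=> /eqP; rewrite scaler_eq0 (negPf a0) (negPf x0).
by rewrite dist0Z // -ltnS subn1 prednK.
Qed.

Lemma card_bad_codes (D : {vspace X}) (k d : nat) :
  (\dim D < \dim {:X})%N -> (0 < d)%N -> (d%:Z%:E <= min_dist dist D)%E ->
  (#|[set C : {vspace X} | [&& (D <= C)%VS, \dim C == k
                             & (min_dist dist C < d%:Z%:E)%E]]|
     * (#|F| - 1) * (#|F| ^ \dim {:X} - #|F| ^ \dim D)
   <= (ball_size dist (d - 1) - 1) *
      (#|superspaces D k| * (#|F| ^ k - #|F| ^ \dim D)))%N.
Proof.
move=> DX d0 dD; set Fam' := [set C | _].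
have [x0 x0D] : exists x : X, x \notin D.
  have /subvPn[x _ xD] : ~~ (fullv <= D)%VS.
    by apply: contraL DX => /dimvS; rewrite leqNgt.
  by exists x.
(* The right side becomes a multiple of the count at [x0], and the common factor [Q^N - Q^t] is
   cancelled. *)
rewrite -(card_superspaces_mem_mul D k x0 x0D) mulnA leq_mul2r; apply/orP; right.
pose A : {set fX} := [set x : fX | (x != 0) && (dist 0 x <= d - 1)%N].
have AD x : x \in A -> x \notin D.
  rewrite inE => /andP[xn0 xd]; apply/negP=> xD.
  by have := min_dist_geP _ _ dD x xD xn0; rewrite leqNgt -(subnK d0) addn1 ltnS xd.
have -> : ((ball_size dist (d - 1) - 1) * #|[set C in superspaces D k | x0 \in C]|
    = \sum_(x : fX | x \in A) #|[set C in superspaces D k | x \in C]|)%N.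
  rewrite -card_ball_notin0 -/A -sum_nat_const.
  by apply: eq_bigr => x /AD xD; apply: card_superspaces_mem.
rewrite (sum_card_superspaces_mem D k (mem A)).
have sub : Fam' \subset superspaces D k.
  by apply/subsetP=> C; rewrite !inE => /and3P[-> ->].
(* Only the bad codes are kept in the sum; each contributes at least [Q - 1] light words. *)
rewrite (big_setID Fam') /= (setIidPr sub) -sum_nat_const.
apply: leq_trans (leq_addr _ _); apply: leq_sum => C; rewrite inE => /and3P[_ _ dC].
rewrite subn1 (leq_trans (leq_card_light_words C d d0 dC)) //.
by apply/subset_leq_card/subsetP=> x; rewrite !inE -andbA.
Qed.

Lemma ler_card_bad_codes (D : {vspace X}) (k d : nat) (Q : rat) :
  Q = #|F|%:R ->
  (\dim D < \dim {:X})%N -> (\dim D <= k)%N -> (0 < d)%N ->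
  (d%:Z%:E <= min_dist dist D)%E ->
  #|[set C : {vspace X} | [&& (D <= C)%VS, \dim C == k
                            & (min_dist dist C < d%:Z%:E)%E]]|%:R
  <= (Q ^+ k - Q ^+ \dim D) / ((Q - 1) * (Q ^+ \dim {:X} - Q ^+ \dim D))
     * ((ball_size dist (d - 1)%N)%:R - 1) * #|superspaces D k|%:R.
Proof.
move=> QE DX Dk d0 dD; have F1 : (1 < #|F|)%N := finNzRing_gt1 F.
have F0 : (0 < #|F|)%N := ltnW F1.
have := card_bad_codes D k d DX d0 dD; rewrite -(ler_nat rat) !natrM.
(* No subtraction is truncated: [\dim D] is at most [k] and [\dim {:X}], and balls contain their
   centre. *)
rewrite !natrB ?leq_pexp2l ?ball_size_gt0 // 1?ltnW // !natrX -QE => le.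
rewrite [_ / _]mulrC -!mulrA ler_pdivlMl.
  by move: le; congr (_ <= _); ring.
have Q1 : 1 < Q by rewrite QE (ltr_nat _ 1).
by rewrite mulr_gt0 // subr_gt0 ?ltr_eXn2l.
Qed.

End Codes.

Theorem theorem5p1 (F : finFieldType) (X : vectType F) (dist : X -> X -> nat)
    (N : nat) (hX : distance_regular dist) (hdim : \dim {: X} = N)
    (hN : (2 <= N)%N) :
  let Q : rat := #|F|%:R in
  let b (r : nat) : rat := (ball_size dist r)%:R in
  (forall (t : nat) (D : {vspace X}) (k d : nat),
     (t < N)%N -> \dim D = t -> (2%:Z%:E <= min_dist dist D)%E ->
     (t <= k <= N)%N -> (2 <= d)%N -> (d%:Z%:E <= min_dist dist D)%E ->
     let Fam := [set C : {vspace X} | (D <= C)%VS && (\dim C == k)] in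
     let Fam' := [set C : {vspace X} | [&& (D <= C)%VS, \dim C == k
                                          & (min_dist dist C < d%:Z%:E)%E]] in
     #|Fam'|%:R / #|Fam|%:R
       <= (Q ^+ k - Q ^+ t) / ((Q - 1) * (Q ^+ N - Q ^+ t)) * (b (d - 1)%N - 1))
  /\
  (forall k d : nat, (k <= N)%N -> (2 <= d)%N ->
     #|[set C : {vspace X} | (\dim C == k) && (min_dist dist C < d%:Z%:E)%E]|%:R
       <= (Q ^+ k - 1) / ((Q - 1) * (Q ^+ N - 1)) * (qbinom F N k)%:R
            * (b (d - 1)%N - 1)).
Proof.
subst N => Q b; have Q1 : 1 < Q by rewrite (ltr_nat _ 1) finNzRing_gt1.
split=> [t D k d tN Dt _ /andP[tk _] d2 dD|k d _ d2].
  lazy zeta; rewrite -/(superspaces D k).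
  have := ler_card_bad_codes hX D k d Q erefl.
  rewrite Dt => /(_ tN tk (ltnW d2) dD); set Fam' := [set C | _] => le.
  (* For an empty family the quotient is 0 by the convention on division by 0, and the bound is
     nonnegative. *)
  have [F0|F0] := posnP #|superspaces D k|.
    rewrite F0 invr0 mulr0 mulr_ge0 ?subr_ge0 ?(ler_nat _ 1) ?(ball_size_gt0 hX) //.
    have Q1' := ltW Q1.
    by rewrite divr_ge0 ?mulr_ge0 ?subr_ge0 ?ler_weXn2l ?(ltnW tN).
  by rewrite ler_pdivrMr ?ltr0n.
have d0 := ltnW d2.
(* The zero code has no nonzero word, so every [d] is admissible for it. *)
have min0 : (d%:Z%:E <= min_dist dist 0%VS)%E.
  by apply/(min_dist_geP hX) => x; rewrite memv0 => /eqP-> /eqP.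
have := ler_card_bad_codes hX 0%VS k d Q erefl.
rewrite dimv0 => /(_ (ltnW hN) isT d0 min0); rewrite expr0 => le.
rewrite [X in X%:R](_ : _ = #|[set C : {vspace X} | [&& (0 <= C)%VS, \dim C == k
                                 & (min_dist dist C < d%:Z%:E)%E]]|); last first.
  by apply: eq_card => C; rewrite !inE sub0v.
apply: le_trans le _; rewrite [X in _ <= X]mulrAC ler_wpM2l //.
  rewrite mulr_ge0 ?subr_ge0 ?(ler_nat _ 1) ?(ball_size_gt0 hX) //.
  have Q1' := ltW Q1.
  by rewrite divr_ge0 ?mulr_ge0 ?subr_ge0 ?exprn_ege1.
rewrite ler_nat (leq_trans _ (leq_card_qbinom k)) //.
by apply/subset_leq_card/subsetP=> C; rewrite !inE => /andP[].
Qed.
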